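(* Let $r\ge 4$ and let $G$ be a $K_r^-$-minor free graph on $n$ vertices. Suppose $A,B\subseteq V(G)$ are disjoint sets with $|A|=r-3$, $|B|=(1-\delta)n$ and $(1-3\delta)n>r$ (for some $\delta\ge0$), such that every vertex of $A$ is adjacent to every vertex of $B$. Let $G^*$ be the graph obtained from $G$ by adding all missing edges inside $A$ so that $A$ becomes a clique. Then $G^*$ is also $K_r^-$-minor free.
   Context: All graphs are finite and simple. $K_r^-$ is the graph obtained from $K_r$ by deleting one edge. A graph $H$ is a minor of $G$ if $H$ can be obtained from $G$ by vertex deletions, edge deletions and edge contractions; $G$ is $H$-minor free if it has no $H$ minor. *)

(* Defs.v *)
From mathcomp Require Import all_boot all_order all_algebra.

Set Implicit Arguments.
Unset Strict Implicit.
Unset Printing Implicit Defensive.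

Record sgraph := SGraph {
  vertex :> finType;
  adj : rel vertex;
  adj_sym : symmetric adj;
  adj_irrefl : irreflexive adj
}.

Definition isomorphic (H G : sgraph) : Prop :=
  exists2 f : H -> G, bijective f & forall u v : H, adj (f u) (f v) = adj u v.

Definition same_pair (T : eqType) (x y u v : T) : bool :=
  (u == x) && (v == y) || (u == y) && (v == x).

Lemma same_pairC (T : eqType) (x y : T) : symmetric (same_pair x y).
Proof. by move=> u v; rewrite /same_pair orbC andbC [X in _ || X]andbC. Qed.

Section MinorOperations.
Variable G : sgraph.

Section DeleteVertex.
Variable x : G.
Definition del_vertex_adj : rel {z : G | z != x} :=
  fun u v => adj (val u) (val v).
Lemma del_vertex_sym : symmetric del_vertex_adj.
Proof. by move=> u v; apply: adj_sym. Qed.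
Lemma del_vertex_irrefl : irreflexive del_vertex_adj.
Proof. by move=> u; apply: adj_irrefl. Qed.
Definition del_vertex : sgraph := SGraph del_vertex_sym del_vertex_irrefl.
End DeleteVertex.

Section DeleteEdge.
Variables x y : G.
Definition del_edge_adj : rel G :=
  fun u v => adj u v && ~~ same_pair x y u v.
Lemma del_edge_sym : symmetric del_edge_adj.
Proof. by move=> u v; rewrite /del_edge_adj adj_sym same_pairC. Qed.
Lemma del_edge_irrefl : irreflexive del_edge_adj.
Proof. by move=> u; rewrite /del_edge_adj adj_irrefl. Qed.
Definition del_edge : sgraph := SGraph del_edge_sym del_edge_irrefl.
End DeleteEdge.

(* Contraction of xy: y is removed and x, which now stands for the merged
   vertex, inherits the neighbours of y; loops and multiple edges vanish. *)
Section ContractEdge.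
Variables x y : G.
Definition contract_adj : rel {z : G | z != y} :=
  fun u v => (val u != val v) &&
    [|| adj (val u) (val v),
        (val u == x) && adj y (val v)
      | (val v == x) && adj (val u) y].
Lemma contract_sym : symmetric contract_adj.
Proof.
move=> u v; rewrite /contract_adj eq_sym (adj_sym (val u) (val v)).
rewrite (adj_sym y (val v)) (adj_sym (val u) y).
by congr (_ && (_ || _)); rewrite orbC.
Qed.
Lemma contract_irrefl : irreflexive contract_adj.
Proof. by move=> u; rewrite /contract_adj eqxx. Qed.
Definition contract_edge : sgraph := SGraph contract_sym contract_irrefl.
End ContractEdge.

End MinorOperations.

Inductive minor (H : sgraph) : sgraph -> Prop :=
| minor_iso (G : sgraph) : isomorphic H G -> minor H G
| minor_del_vertex (G : sgraph) (x : G) :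
    minor H (del_vertex x) -> minor H G
| minor_del_edge (G : sgraph) (x y : G) :
    adj x y -> minor H (del_edge x y) -> minor H G
| minor_contract_edge (G : sgraph) (x y : G) :
    adj x y -> minor H (contract_edge x y) -> minor H G.

Definition minor_free (H G : sgraph) : Prop := ~ minor H G.

(* K_r minus an edge, the missing edge being the one between 0 and 1.  This is
   only meant for r >= 2: for smaller r there is no edge to remove. *)
Section CompleteMinusEdge.
Variable r : nat.
Definition Kminus_adj : rel 'I_r :=
  fun i j => (i != j) && ~~ same_pair 0 1 (val i) (val j).
Lemma Kminus_sym : symmetric Kminus_adj.
Proof. by move=> i j; rewrite /Kminus_adj eq_sym same_pairC. Qed.
Lemma Kminus_irrefl : irreflexive Kminus_adj.
Proof. by move=> i; rewrite /Kminus_adj eqxx. Qed.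
Definition Kminus : sgraph := SGraph Kminus_sym Kminus_irrefl.
End CompleteMinusEdge.

Section MakeClique.
Variables (G : sgraph) (A : {set G}).
Definition make_clique_adj : rel G :=
  fun u v => adj u v || [&& u != v, u \in A & v \in A].
Lemma make_clique_sym : symmetric make_clique_adj.
Proof.
move=> u v; rewrite /make_clique_adj adj_sym eq_sym.
by congr (_ || (_ && _)); rewrite andbC.
Qed.
Lemma make_clique_irrefl : irreflexive make_clique_adj.
Proof. by move=> u; rewrite /make_clique_adj adj_irrefl eqxx. Qed.
Definition make_clique : sgraph := SGraph make_clique_sym make_clique_irrefl.
End MakeClique.

(* Main.v *)
(** Since [B] is much larger than [A], any [|A|] vertices of [B] unused by a
    minor of [G*] can be absorbed by its branch sets meeting [A]; these then
    become connected and pairwise adjacent through [B], so that a minor of [G*]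
    leaving [|A|] vertices of [B] unused is already a minor of [G].  Hence a
    component of [G - A] contains at most two vertices of [B]: three of them
    would provide a path on three branch sets completely joined to [A], i.e. a
    [K_r^-].  Given a [K_r^-] minor of [G*], at least three branch sets avoid
    [A]; together they are connected in [G - A], hence lie in one component [C].
    As [A] is a clique of [G*], the minor can be restricted to the union of [A]
    and [C], which leaves all but two vertices of [B] unused. *)

Require Import Defs.
From mathcomp Require Import all_boot all_order all_algebra.
From mathcomp Require Import lra.

Set Implicit Arguments.
Unset Strict Implicit.
Unset Printing Implicit Defensive.

Import Order.TTheory GRing.Theory Num.Theory.

(** * Connectivity in finite relations *)

Lemma connect_homo (T T' : finType) (g : T -> T') (e : rel T) (e' : rel T') :
    (forall x y, e x y -> connect e' (g x) (g y)) ->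
  forall x y, connect e x y -> connect e' (g x) (g y).
Proof.
move=> homo_g x _ /connectP[p ep ->].
elim: p x ep => //= y p IHp x /andP[exy ep].
exact: connect_trans (homo_g _ _ exy) (IHp _ ep).
Qed.

Lemma connect_crossing (T : finType) (e : rel T) (X : pred T) x y :
  connect e x y -> X x -> ~~ X y -> exists u v, [/\ X u, ~~ X v & e u v].
Proof.
case/connectP=> p + ->.
elim: p x => [|z p IHp] x /=; first by move=> _ ->.
case/andP=> exz ep Xx nXl; case Xz: (X z); first exact: IHp ep Xz nXl.
by exists x, z; rewrite Xx Xz exz.
Qed.

Definition induced (T : finType) (e : rel T) (P : pred T) : rel T :=
  fun x y => [&& e x y, P x & P y].
Arguments induced T e P x y /.

Lemma induced_sym (T : finType) (e : rel T) (P : pred T) :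
  symmetric e -> connect_sym (induced e P).
Proof.
move=> sym_e; apply: sym_connect_sym => x y /=.
by rewrite /= sym_e [P y && _]andbC.
Qed.

(** * Minors as families of branch sets *)

Definition fiber (T : finType) (V : eqType) (f : T -> option V) (h : V) : pred T :=
  fun v => f v == Some h.
Arguments fiber T V f h v /.

(* A labelling by [H], with [None] on the vertices deleted, whose fibers are
   the branch sets of an [H] minor. *)
Record model (H : sgraph) (T : finType) (e : rel T) (f : T -> option H) : Prop :=
  Model {
  model_onto : forall h, exists v, f v = Some h;
  model_conn : forall h u v, f u = Some h -> f v = Some h ->
    connect (induced e (fiber f h)) u v;
  model_adj : forall h k, adj h k ->
    exists u v, [/\ f u = Some h, f v = Some k & e u v] }.

(** Each operation is undone on labellings: deleted vertices get [None], deleted edges return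
    without harm, and a contracted vertex shares its label with both ends of its edge. *)
Lemma minor_model (H G : sgraph) : minor H G -> exists f, model (H := H) (@adj G) f.
Proof.
elim=> {G} [G [g [g' gK g'K] g_adj]|G x _ [f Mf]|G x y xy _ [f Mf]|G x y xy _ [f Mf]].
- exists (fun v => Some (g' v)); split=> [h|h u v [<-] [/(can_inj g'K) ->]|h k hk].
  + by exists (g h); rewrite gK.
  + exact: connect0.
  + by exists (g h), (g k); rewrite !gK g_adj.
- pose F v := obind f (insub v : option {z : G | z != x}).
  have FE (w : {z : G | z != x}) : F (sval w) = f w by rewrite /F (valK w).
  have F_inv v h : F v = Some h ->
      exists2 w : {z : G | z != x}, v = sval w & f w = Some h.
    by rewrite /F; case: insubP => //= w _ <-; exists w.
  exists F; split=> [h|h u v /F_inv[u' -> fu] /F_inv[v' -> fv]|h k hk].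
  + by have [w fw] := model_onto Mf h; exists (sval w); rewrite FE.
  + apply: (connect_homo (g := sval)) (model_conn Mf fu fv) => a b ab; apply: connect1.
    by rewrite /= !FE.
  + by have [u [v [fu fv uv]]] := model_adj Mf hk; exists (sval u), (sval v); rewrite !FE.
- exists f; split=> [h|h u v fu fv|h k hk]; first exact: (model_onto Mf h).
  + apply: connect_homo (model_conn Mf fu fv) => a b /= /and3P[/andP[ab _] fa fb].
    by apply: connect1; rewrite /= ab fa fb.
  + have [u [v [fu fv /andP[uv _]]]] := model_adj Mf hk.
    by exists u, v.
- have nxy : x != y by apply: contraTneq xy => ->; rewrite adj_irrefl.
  pose x' : {z : G | z != y} := Sub x nxy.
  (* On [y], the only vertex outside the subtype, [insubd] returns its default [x']; hence [y] joins
     the branch set of [x], and [step] reroutes inherited edges through [y]. *)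
  pose F v := f (insubd x' v).
  have FE (w : {z : G | z != y}) : F (sval w) = f w by rewrite /F (valKd x' w).
  have Fx : F x = f x' by rewrite -FE.
  have Fy : F y = f x' by rewrite /F /insubd insubF ?eqxx.
  have F_inv v : v = y \/ exists w : {z : G | z != y}, v = sval w.
    case: (eqVneq v y) => [|vy]; [by left | by right; exists (Sub v vy)].
  have step h (a b : {z : G | z != y}) : f a = Some h -> f b = Some h ->
      contract_adj x a b -> connect (induced (@adj G) (fiber F h)) (sval a) (sval b).
    move=> fa fb /andP[_ /or3P[ab|/andP[/eqP ax yb]|/andP[/eqP bx ay]]].
    * by apply: connect1; rewrite /= ab !FE fa fb eqxx.
    * have fx : f x' = Some h by rewrite -fa; congr f; apply: val_inj.
      rewrite ax; apply: (@connect_trans _ _ y); apply: connect1;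
        by rewrite /= ?Fx ?Fy ?FE ?fb ?fx ?xy ?yb !eqxx.
    * have fx : f x' = Some h by rewrite -fb; congr f; apply: val_inj.
      rewrite bx; apply: (@connect_trans _ _ y); apply: connect1;
        by rewrite /= ?Fx ?Fy ?FE ?fa ?fx ?ay 1?adj_sym ?xy !eqxx.
  have to_x h : f x' = Some h -> connect (induced (@adj G) (fiber F h)) y x.
    by move=> fx; apply: connect1; rewrite /= Fx Fy fx adj_sym xy !eqxx.
  have sym h := induced_sym (fiber F h) (@adj_sym G).
  exists F; split=> [h|h u v Fu Fv|h k hk].
  + by have [w fw] := model_onto Mf h; exists (sval w); rewrite FE.
  + have down w : F w = Some h ->
        connect (induced (@adj G) (fiber F h)) w (sval (insubd x' w)).
      case: (F_inv w) => [->|[w' ->]]; last by rewrite (valKd x' w') connect0.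
      by rewrite Fy /insubd insubF ?eqxx //=; apply: to_x.
    apply: connect_trans (down _ Fu) _; rewrite sym.
    apply: connect_trans (down _ Fv) _; rewrite sym.
    apply: (connect_homo (g := sval)) (model_conn Mf Fu Fv).
    by move=> a b /and3P[ab /eqP fa /eqP fb]; apply: step.
  + have [u [v [fu fv /andP[_ /or3P[uv|/andP[/eqP ux yv]|/andP[/eqP vx uy]]]]]] :=
      model_adj Mf hk.
    * by exists (sval u), (sval v); rewrite !FE.
    * by exists y, (sval v); rewrite FE Fy -fu; split=> //; congr f; apply: val_inj.
    * by exists (sval u), y; rewrite FE Fy -fv; split=> //; congr f; apply: val_inj.
Qed.

(** Induction on the number of edges: an edge whose image is not an edge of [H] is deleted, and once
    none is left the bijection is an isomorphism. *)
Lemma bij_minor (H G : sgraph) (f : G -> H) :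
  bijective f ->
  (forall h k, adj h k -> exists u v, [/\ f u = h, f v = k & adj u v]) ->
  minor H G.
Proof.
have [m] := ubnP #|[set p : G * G | adj p.1 p.2]|.
elim: m G f => // m IHm G f ltm bij_f adj_f; have [g fK gK] := bij_f.
have g_adj h k : adj h k -> adj (g h) (g k).
  by case/adj_f=> u [v [<- <-]]; rewrite !fK.
case: (pickP [pred p : G * G | adj p.1 p.2 && ~~ adj (f p.1) (f p.2)]) =>
    [[x y] /= /andP[xy nfxy]|f_adj].
  apply: (minor_del_edge xy); apply: (IHm (del_edge x y) f) => //.
    rewrite -ltnS (leq_trans _ ltm) // ltnS; apply: proper_card; apply/properP; split.
      by apply/subsetP=> p; rewrite !inE => /andP[].
    by exists (x, y); rewrite inE /= /del_edge_adj ?xy //= /same_pair !eqxx.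
  move=> h k hk; have [u [v [fu fv uv]]] := adj_f h k hk.
  exists u, v; split=> //=; rewrite /del_edge_adj uv /=.
  apply: contra nfxy => /orP[] /andP[/eqP <- /eqP <-]; rewrite fu fv //.
  by rewrite adj_sym.
apply: minor_iso; exists g; first by exists f.
move=> h k; apply/idP/idP => [ghk|]; last exact: g_adj.
by have:= f_adj (g h, g k); rewrite /= ghk !gK => /negbFE.
Qed.

(** Induction on the number of vertices: an unlabelled vertex is deleted, otherwise an edge inside a
    branch set is contracted. When neither exists, the branch sets are singletons and only surplus
    edges remain, which [bij_minor] handles. *)
Lemma model_minor (H G : sgraph) (f : G -> option H) :
  model (@adj G) f -> minor H G.
Proof.
have [m] := ubnP #|G|; elim: m G f => // m IHm G f ltm Mf.
have card_del (y : G) : #|{: {z : G | z != y}}| < m.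
  rewrite card_sig -ltnS (leq_trans _ ltm) // ltnS; apply: proper_card.
  by apply/properP; split; [apply/subsetP | exists y; rewrite ?inE ?eqxx].
case: (pickP (fun x => f x == None)) => [x /eqP fx|f_some].
  have nx v h : f v = Some h -> v != x by apply: contra_eqN => /eqP->; rewrite fx.
  apply: (minor_del_vertex (x := x)).
  apply: (IHm (del_vertex x) (fun w => f (sval w))); first exact: card_del.
  split=> [h|h u v fu fv|h k hk].
  - by have [v fv] := model_onto Mf h; exists (Sub v (nx _ _ fv)).
  - have:= model_conn Mf fu fv.
    move/(connect_homo (g := insubd u)
      (e' := induced (@del_vertex_adj G x) (fiber (fun w => f (sval w)) h))).
    rewrite !valKd; apply=> a b /and3P[ab /eqP fa /eqP fb].
    apply: connect1; rewrite /= /del_vertex_adj !val_insubd.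
    by rewrite (nx _ _ fa) (nx _ _ fb) fa fb ab eqxx.
  - have [u [v [fu fv uv]]] := model_adj Mf hk.
    by exists (Sub u (nx _ _ fu)), (Sub v (nx _ _ fv)).
case: (pickP [pred p : G * G | adj p.1 p.2 && (f p.1 == f p.2)]) =>
    [[x y] /= /andP[xy /eqP fxy]|no_edge].
  have nxy : x != y by apply: contraTneq xy => ->; rewrite adj_irrefl.
  pose x' : {z : G | z != y} := Sub x nxy.
  pose c v := insubd x' v : {z : G | z != y}.
  have cE v : val (c v) = if v != y then v else x by rewrite /c val_insubd.
  have cK w : c (val w) = w by apply: valKd.
  have fc v : f (val (c v)) = f v.
    by rewrite cE; case: eqP => //= ->.
  have c_adj u v : adj u v -> val (c u) != val (c v) -> contract_adj x (c u) (c v).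
    rewrite /contract_adj => uv -> /=; rewrite !cE.
    have [ey|nu] := eqVneq u y; have [ey'|nv] := eqVneq v y => /=.
    + by move: uv; rewrite ey ey' adj_irrefl.
    + by rewrite -ey uv eqxx orbT.
    + by rewrite -ey' uv eqxx !orbT.
    + by rewrite uv.
  apply: (minor_contract_edge xy).
  apply: (IHm (contract_edge x y) (fun w => f (sval w))); first exact: card_del.
  split=> [h|h u v fu fv|h k hk].
  - by have [v fv] := model_onto Mf h; exists (c v); rewrite fc.
  - have:= model_conn Mf fu fv.
    move/(connect_homo (g := c)
      (e' := induced (@contract_adj G x y) (fiber (fun w => f (sval w)) h))).
    rewrite !cK; apply=> a b /= /and3P[ab fa fb].
    have [/val_inj->|nab] := eqVneq (val (c a)) (val (c b)); first exact: connect0.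
    by apply: connect1; rewrite /= !fc fa fb c_adj.
  - have [u [v [fu fv uv]]] := model_adj Mf hk.
    exists (c u), (c v); rewrite !fc; split=> //; apply: c_adj => //.
    apply: contraTneq hk => ecuv; suff -> : h = k by rewrite adj_irrefl.
    by apply: Some_inj; rewrite -fu -fv -(fc u) ecuv fc.
(* A nontrivial path inside a branch set would begin with an edge excluded by [no_edge]. *)
have f_inj u v : f u = f v -> u = v.
  move=> fuv; case fv: (f v) => [h|]; last by have:= f_some v; rewrite fv.
  have:= model_conn Mf (etrans fuv fv) fv.
  case/connectP=> [[|w p] //= /andP[/and3P[uw /eqP fu /eqP fw] _] _].
  by have:= no_edge (u, w); rewrite /= uw fu fw eqxx.
have F_ex v : exists h, f v == Some h.
  by have:= f_some v; case: (f v) => // h _; exists h.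
pose F v := xchoose (F_ex v).
have FE v : f v = Some (F v) by apply: eqP (xchooseP (F_ex v)).
have G_ex h : exists v, f v == Some h.
  by have [v fv] := model_onto Mf h; exists v; apply/eqP.
apply: (@bij_minor _ _ F).
  exists (fun h => xchoose (G_ex h)).
    by move=> v; apply: f_inj; rewrite (eqP (xchooseP (G_ex _))) FE.
  by move=> h; apply: Some_inj; rewrite -FE (eqP (xchooseP (G_ex _))).
move=> h k hk; have [u [v [fu fv uv]]] := model_adj Mf hk.
by exists u, v; split=> //; apply: Some_inj; rewrite -FE.
Qed.

(** * Components of induced subgraphs *)

(** If [P t] holds, this is the component of [t] in the subgraph induced on [P]; otherwise it is
    just the singleton of [t], since [connect] is reflexive. *)
Definition region (G : sgraph) (P : pred G) (t : G) : {set G} :=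
  [set v | connect (induced (@adj G) P) t v].

Section Region.
Variables (G : sgraph) (P : pred G) (t : G).

Lemma region_refl : t \in region P t.
Proof. by rewrite inE connect0. Qed.

Lemma region_sub v : P t -> v \in region P t -> P v.
Proof.
rewrite inE => Pt tv; apply: contraT => nPv.
have [u [w [_ nPw]]] := connect_crossing tv Pt nPv.
by rewrite /= (negPf nPw) !andbF.
Qed.

Lemma region_step u v :
  P t -> u \in region P t -> adj u v -> P v -> v \in region P t.
Proof.
move=> Pt tu uv Pv; have Pu := region_sub Pt tu; move: tu; rewrite !inE => tu.
by apply: connect_trans tu (connect1 _); rewrite /= uv Pu.
Qed.

(** Every vertex on a path from [t] inside [P] is itself in the region, so the path never leaves
    it. *)
Lemma region_connected u v :
  u \in region P t -> v \in region P t ->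
  connect (induced (@adj G) (mem (region P t))) u v.
Proof.
have from_t w : w \in region P t -> connect (induced (@adj G) (mem (region P t))) t w.
  rewrite inE => /connectP[p + ->].
  have: t \in region P t := region_refl.
  elim: p {1 3 5 6}t => [|z p IHp] x tx /=; first by rewrite connect0.
  case/andP=> xz zp; have tz : z \in region P t.
    by move: tx; rewrite !inE => /connect_trans; apply; apply: connect1.
  apply: connect_trans (IHp z tz zp); apply: connect1.
  by case/and3P: xz => xz _ _; rewrite /= xz tx.
move=> tu tv; apply: connect_trans (from_t v tv).
by rewrite (induced_sym _ (@adj_sym G)) from_t.
Qed.

End Region.

Section CommonNeighbours.
Variables (G : sgraph) (A B : {set G}).
Hypothesis dAB : [disjoint A & B].
Hypothesis adjAB : forall a b : G, a \in A -> b \in B -> adj a b.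

Lemma make_clique_minor (H : sgraph) (f : G -> option H) :
  model (make_clique_adj A) f -> #|A| <= #|[set b in B | f b == None]| ->
  minor H G.
Proof.
set S := [set b in B | _] => Mf leAS.
pose F v := if v \in S then nth None (map f (enum A)) (index v (enum S)) else f v.
have F_ext v h : f v = Some h -> F v = Some h.
  by rewrite /F inE => ->; rewrite andbF.
have S_adj b a : b \in S -> a \in A -> adj b a.
  by rewrite inE adj_sym => /andP[Bb _] Aa; apply: adjAB.
have S_inv b h : b \in S -> F b = Some h -> exists2 a, a \in A & f a = Some h.
  rewrite /F => Sb; rewrite Sb.
  have [ge|lt] := leqP (size (map f (enum A))) (index b (enum S)).
    by rewrite nth_default.
  move=> Fb; have := mem_nth None lt; rewrite Fb => /mapP[a].
  by rewrite mem_enum; exists a.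
have S_onto a : a \in A -> exists2 b, b \in S & F b = f a.
  move=> Aa; have lt : index a (enum A) < size (enum S).
    by rewrite -cardE; apply: leq_trans leAS; rewrite cardE index_mem mem_enum.
  have Sb : nth a (enum S) (index a (enum A)) \in S by rewrite -mem_enum mem_nth.
  exists (nth a (enum S) (index a (enum A))) => //.
  rewrite /F Sb index_uniq ?enum_uniq // (nth_map a) ?nth_index ?mem_enum //.
  by rewrite index_mem mem_enum.
have sym h := induced_sym (fiber F h) (@adj_sym G).
have down h w : F w = Some h -> exists2 w', f w' = Some h &
    connect (induced (@adj G) (fiber F h)) w w'.
  move=> Fw; case Sw: (w \in S).
    have [a Aa fa] := S_inv _ _ Sw Fw.
    by exists a => //; apply: connect1; rewrite /= S_adj // Fw (F_ext _ _ fa) eqxx.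
  by exists w; rewrite ?connect0 // -Fw /F Sw.
apply: (@model_minor _ _ F); split=> [h|h u v Fu Fv|h k hk].
- by have [v fv] := model_onto Mf h; exists v; apply: F_ext.
- have [u' fu uu'] := down _ _ Fu; have [v' fv vv'] := down _ _ Fv.
  apply: connect_trans uu' _; rewrite sym; apply: connect_trans vv' _; rewrite sym.
  apply: (connect_homo (g := id)) (model_conn Mf fu fv) => x y /=.
  case/and3P=> /orP[xy|/and3P[_ Ax Ay]] /eqP fx /eqP fy.
    by apply: connect1; rewrite /= xy (F_ext _ _ fx) (F_ext _ _ fy) eqxx.
  have [b Sb] := S_onto _ Ax; rewrite fx => Fb.
  apply: (@connect_trans _ _ b); apply: connect1.
    by rewrite /= adj_sym S_adj // (F_ext _ _ fx) Fb eqxx.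
  by rewrite /= S_adj // (F_ext _ _ fy) Fb eqxx.
- have [u [v [fu fv]]] := model_adj Mf hk.
  case/orP=> [uv|/and3P[_ Au Av]]; first by exists u, v; rewrite (F_ext u h) ?(F_ext v k).
  have [b Sb] := S_onto _ Au; rewrite fu => Fb.
  by exists b, v; rewrite (F_ext v k) // S_adj.
Qed.

(** * Components of [G - A] contain few vertices of [B] *)

(* The fibers of [l] over [0], [1] and [2] become branch sets; a label of at
   least [3] means that [l] leaves the vertex unused. *)
Lemma Kminus_of_labels (l : G -> nat) :
    (forall a, a \in A -> 3 <= l a) ->
    (forall i, i < 3 -> exists2 t, t \in B & l t = i) ->
    (forall u v, l u < 3 -> l u = l v ->
       connect (induced (@adj G) (fun w => l w == l u)) u v) ->
    (forall i, i < 2 -> exists u v, [/\ l u = i, l v = 2 & adj u v]) ->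
  exists2 f : G -> option (Kminus (#|A| + 3)), model (make_clique_adj A) f &
    forall v, v \notin A -> 3 <= l v -> f v = None.
Proof.
move=> lA l_onto l_conn l_adj.
(* The vertices of [A] are numbered from 3 on as singleton branch sets. The value [#|A| + 3] is just
   out of range, so that [insub] turns it into [None]. *)
pose k v := if l v < 3 then l v else
            if v \in A then 3 + index v (enum A) else #|A| + 3.
pose f v : option 'I_(#|A| + 3) := insub (k v).
have fP v h : f v = Some h <-> k v = h :> nat.
  rewrite /f; split=> [|->]; last exact: valK.
  by case: insubP => // w _ <- [->].
have kl v : l v < 3 -> k v = l v by rewrite /k => ->.
have kA a : a \in A -> k a = 3 + index a (enum A).
  by move=> Aa; rewrite /k ltnNge lA //= Aa.
have kge v : 3 <= l v -> v \notin A -> k v = #|A| + 3.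
  by move=> lv nAv; rewrite /k ltnNge lv (negPf nAv).
have k3 v : 3 <= l v -> 3 <= k v.
  move=> lv; have [/kA->|/(kge v lv)->] := boolP (v \in A); first exact: leq_addr.
  exact: leq_addl.
have A_onto i : 3 <= i -> i < #|A| + 3 -> exists2 a, a \in A & k a = i.
  move=> i3 ir; have lt : i - 3 < #|A| by rewrite ltn_subLR // addnC.
  have /card_gt0P[x0 _] : 0 < #|A| by apply: leq_trans lt.
  have An : nth x0 (enum A) (i - 3) \in A by rewrite -mem_enum mem_nth -?cardE.
  exists (nth x0 (enum A) (i - 3)) => //.
  by rewrite kA // index_uniq ?enum_uniq -?cardE // subnKC.
have k_onto i : i < #|A| + 3 -> exists v, k v = i.
  case: (ltnP i 3) => [lt3 _|ge3 /(A_onto _ ge3)[a _ <-]]; last by exists a.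
  by have [t _ lt] := l_onto i lt3; exists t; rewrite kl lt.
(* Among the labels below 3 only the pairs ending in 2 remain; a label below 3 meets [A] through its
   vertex of [B], and two labels from 3 on are adjacent in the clique. *)
have k_adj i j : i < j -> j < #|A| + 3 -> (i, j) != (0, 1) ->
    exists u v, [/\ k u = i, k v = j & make_clique_adj A u v].
  move=> ij jr nij; have [j3|j3] := ltnP j 3.
    have j2 : j = 2.
      by case: j j3 ij nij {jr} => [|[|[|j]]] //; case: i => [|i].
    have [|u [v [lu lv uv]]] := l_adj i; first by rewrite -j2.
    exists u, v; rewrite !kl ?lu ?lv ?j2 //; last by rewrite -j2 (ltn_trans ij).
    by rewrite /make_clique_adj uv.
  have [a Aa ka] := A_onto j j3 jr; have [i3|i3] := ltnP i 3.
    have [t Bt lt] := l_onto i i3.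
    by exists t, a; rewrite kl lt // ka /make_clique_adj adj_sym adjAB.
  have [b Ab kb] := A_onto i i3 (ltn_trans ij jr).
  exists b, a; rewrite ka kb /make_clique_adj Aa Ab !andbT; split=> //.
  by apply/orP; right; apply: contraTneq ij => ba; rewrite -ka -kb ba ltnn.
exists f; last first.
  by move=> v nAv lv; rewrite /f insubF // kge // ltnn.
split=> [h|h u v /fP ku /fP kv|h h' hh'].
- by have [v kv] := k_onto h (ltn_ord h); exists v; apply/fP.
- have [lu|lu] := ltnP (l u) 3.
    have lv : l v < 3.
      by rewrite ltnNge; apply/negP => /k3; rewrite kv -ku kl // leqNgt lu.
    have luv : l u = l v by rewrite -(kl u lu) -(kl v lv) ku kv.
    apply: (connect_homo (g := id)) (l_conn u v lu luv) => x y.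
    case/and3P=> xy /eqP lx /eqP ly; apply: connect1.
    rewrite /= /make_clique_adj xy /=; apply/andP; split; apply/eqP/fP;
      by rewrite kl ?lx ?ly // -(kl u lu).
  have kI w : k w = h -> 3 <= k w -> w \in A.
    move=> kw kw3; apply: contraT => nAw.
    have [lw|lw] := ltnP (l w) 3; first by move: kw3; rewrite kl // leqNgt lw.
    by have := ltn_ord h; rewrite -kw kge // ltnn.
  have ku3 := k3 u lu.
  have Au := kI u ku ku3; have Av : v \in A by apply: kI; rewrite // kv -ku.
  suff -> : u = v by apply: connect0.
  apply: (@index_inj _ u (enum A)); rewrite ?mem_enum //.
  by apply: (@addnI 3); rewrite -(kA u Au) -(kA v Av) ku kv.
- have /andP[nhh' /norP[n01 n10]] : Kminus_adj h h' by [].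
  case: (ltngtP h h') => [lt|gt|/val_inj eq]; last by rewrite eq eqxx in nhh'.
    have [u [v [ku kv uv]]] := k_adj h h' lt (ltn_ord h') n01.
    by exists u, v; split=> //; apply/fP.
  have [|u [v [ku kv uv]]] := k_adj h' h gt (ltn_ord h).
    by move: n10; rewrite andbC.
  by exists v, u; split; [apply/fP | apply/fP | rewrite make_clique_sym].
Qed.

(* If [X1] and [X2] are maximal connected sets with one [B]-vertex each, then
   a third [B]-vertex [z] of the region is adjacent to one of them, so that
   [X1], [X2] and [z] contract to a path on three vertices, completely joined
   to [A]. *)
Lemma region_few c :
  minor_free (Kminus (#|A| + 3)) G -> #|A| + 3 <= #|B| -> c \notin A ->
  #|B :&: region (predC (mem A)) c| <= 2.
Proof.
move=> freeG leAB nAc; set C := region _ c; rewrite leqNgt; apply/negP => gt2.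
have CA v : v \in C -> v \notin A by apply: region_sub.
have C_conn t v : t \in C -> v \in C ->
    connect (induced (@adj G) (predC (mem A))) t v.
  rewrite !inE => ct; apply: connect_trans.
  by rewrite (induced_sym _ (@adj_sym G)).
have pickBC (X : {set G}) : #|X| <= 2 -> exists2 v, v \in B :&: C & v \notin X.
  move=> leX; apply/subsetPn; apply: contraL gt2 => /subset_leq_card leBX.
  by rewrite -leqNgt (leq_trans leBX).
have [t BCt _] : exists2 v, v \in B :&: C & v \notin set0 by apply: pickBC; rewrite cards0.
have [Bt Ct] := setIP BCt.
(* [P1] admits [t] as the only vertex of [B], so [X1] is a maximal connected set avoiding [A] and
   all other vertices of [B]. *)
pose P1 v := (v \notin A) && ((v == t) || (v \notin B)).
have P1t : P1 t by rewrite /P1 CA ?eqxx.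
pose X1 := region P1 t; have X1t : t \in X1 by apply: region_refl.
have X1P v : v \in X1 -> P1 v by apply: region_sub.
have X1B v : v \in X1 -> v \in B -> v = t.
  by move=> /X1P/andP[_ /orP[/eqP|/negP]].
have [y0 BCy0 ny0] := pickBC [set t] (leq_trans (eq_leq (cards1 t)) (leqnSn 1)).
(* A path in [G - A] from [t] to another vertex of [B] must leave [X1]; by maximality its first
   vertex outside lies in [B]. *)
have [x1 [y [X1x1 nX1y /and3P[x1y _ nAy]]]] :
    exists u v, [/\ u \in X1, v \notin X1 & induced (@adj G) (predC (mem A)) u v].
  have [By0 Cy0] := setIP BCy0.
  apply: (connect_crossing (C_conn _ _ Ct Cy0) X1t).
  by apply: contra ny0 => /X1B <- //; rewrite inE.
rewrite /= in nAy.
have By : y \in B.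
  apply: contraNT nX1y => nBy; apply: region_step X1x1 x1y _ => //.
  by rewrite /P1 nAy nBy orbT.
pose P2 v := [&& v \notin A, v \notin X1 & (v == y) || (v \notin B)].
have P2y : P2 y by rewrite /P2 nAy nX1y eqxx.
pose X2 := region P2 y; have X2y : y \in X2 by apply: region_refl.
have X2P v : v \in X2 -> P2 v by apply: region_sub.
have X2B v : v \in X2 -> v \in B -> v = y.
  by move=> /X2P/and3P[_ _ /orP[/eqP|/negP]].
have [z0 /setIP[Bz0 Cz0] nz0] : exists2 v, v \in B :&: C & v \notin [set t; y].
  by apply: pickBC; rewrite cards2; case: eqP.
(* The same argument for the union of [X1] and [X2]: the exit vertex [z] is in [B], and [x] shows
   which of the two sets it is attached to. *)
have [x [z [X12x nX12z /and3P[xz _ nAz]]]] : exists u v, [/\ u \in X1 :|: X2,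
    v \notin X1 :|: X2 & induced (@adj G) (predC (mem A)) u v].
  apply: (connect_crossing (C_conn _ _ Ct Cz0)); first by rewrite in_setU X1t.
  apply: contra nz0 => /setUP[/X1B|/X2B] <- //; by rewrite !inE eqxx ?orbT.
rewrite /= in nAz.
have /norP[nX1z nX2z] : ~~ ((z \in X1) || (z \in X2)) by rewrite -in_setU.
have Bz : z \in B.
  apply: contraT => nBz; case/setUP: X12x => [X1x|X2x].
    by case/negP: nX1z; apply: region_step X1x xz _; rewrite // /P1 nAz nBz orbT.
  by case/negP: nX2z; apply: region_step X2x xz _; rewrite // /P2 nAz nX1z nBz orbT.
pose i1 := if x \in X1 then 2 else 0; pose i2 := if x \in X1 then 0 else 2.
pose l v := if v \in X1 then i1 else if v \in X2 then i2 else if v == z then 1 else 3.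
have l1 v : v \in X1 -> l v = i1 by rewrite /l => ->.
have X2nX1 v : v \in X2 -> v \notin X1 by move=> /X2P/and3P[].
have l2 v : v \in X2 -> l v = i2 by move=> X2v; rewrite /l (negPf (X2nX1 v X2v)) X2v.
have lz : l z = 1 by rewrite /l (negPf nX1z) (negPf nX2z) eqxx.
have l_inv v :
    [/\ l v = i1 -> v \in X1, l v = i2 -> v \in X2 & l v = 1 -> v = z].
  rewrite /l /i1 /i2.
  by case: (x \in X1); case: (v \in X1); case: (v \in X2); case: (v =P z).
have lA a : a \in A -> 3 <= l a.
  move=> Aa; rewrite /l ifN; last by apply/negP => /X1P; rewrite /P1 Aa.
  rewrite ifN; last by apply/negP => /X2P; rewrite /P2 Aa.
  by case: eqP => // eaz; rewrite -eaz Aa in nAz.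
have l_onto i : i < 3 -> exists2 t, t \in B & l t = i.
  have lt := l1 t X1t; have ly := l2 y X2y; rewrite /i1 /i2 in lt ly.
  case: i => [|[|[|]]] // _; [|by exists z|].
    by case: (x \in X1) lt ly => lt ly; [exists y | exists t].
  by case: (x \in X1) lt ly => lt ly; [exists t | exists y].
have l_conn u v : l u < 3 -> l u = l v ->
    connect (induced (@adj G) (fun w => l w == l u)) u v.
  move=> lu luv; have [v1 v2 v3] := l_inv v.
  case X1u: (u \in X1).
    have X1v : v \in X1 by rewrite v1 // -luv l1.
    apply: (connect_homo (g := id)) (region_connected X1u X1v) => a b /and3P[ab X1a X1b].
    by apply: connect1; rewrite /= ab !l1 ?eqxx.
  case X2u: (u \in X2).
    have X2v : v \in X2 by rewrite v2 // -luv l2.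
    apply: (connect_homo (g := id)) (region_connected X2u X2v) => a b /and3P[ab X2a X2b].
    by apply: connect1; rewrite /= ab !l2 ?eqxx.
  move: lu luv; rewrite {1 2}/l X1u X2u; case: eqP => // -> _ lv.
  by rewrite v3 ?connect0.
have l_adj i : i < 2 -> exists u v, [/\ l u = i, l v = 2 & adj u v].
  have lx1 := l1 x1 X1x1; have ly := l2 y X2y; rewrite /i1 /i2 in lx1 ly.
  case: i => [|[|]] // _.
    case: (x \in X1) lx1 ly => lx1 ly; last by exists x1, y.
    by exists y, x1; rewrite adj_sym.
  exists z, x; rewrite adj_sym; split=> //; case/setUP: X12x => [X1x|X2x].
    by rewrite l1 // /i1 X1x.
  by rewrite l2 // /i2 (negPf (X2nX1 x X2x)).
have [f Mf fN] := Kminus_of_labels lA l_onto l_conn l_adj.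
apply/freeG/(make_clique_minor Mf).
(* The branch sets use only [t], [y] and [z] from [B], which leaves at least [#|A|] vertices to
   absorb. *)
apply: (@leq_trans #|B :\: [set t; y; z]|).
  have le3 : #|[set t; y; z]| <= 3.
    by apply: leq_trans (leq_card_setU _ _) _; rewrite cards1 cards2; case: eqP.
  rewrite cardsD -(leq_add2r 3) (leq_trans leAB) // addnC -leq_subLR leq_sub2l //.
  exact: leq_trans (subset_leq_card (subsetIr _ _)) le3.
apply/subset_leq_card/subsetP => b; case/setDP=> Bb; rewrite !inE => /norP[/norP[nbt nby] nbz].
rewrite Bb; apply/eqP/fN; first by rewrite (disjointFl dAB).
rewrite /l ifN; last by apply: contra nbt => /X1B ->.
rewrite ifN; last by apply: contra nby => /X2B ->.
by rewrite (negPf nbz).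
Qed.

(** * Restricting a minor to [A] and one component *)

Lemma make_clique_minor_free :
  #|A| + 3 <= #|B| -> minor_free (Kminus (#|A| + 3)) G ->
  minor_free (Kminus (#|A| + 3)) (make_clique A).
Proof.
move=> leAB freeG /minor_model[f Mf0].
have {Mf0} Mf : model (make_clique_adj A) f := Mf0.
pose missing := [set h : Kminus (#|A| + 3) | [forall a in A, f a != Some h]].
have meetA h : h \notin missing -> exists2 a, a \in A & f a = Some h.
  by rewrite inE negb_forall_in => /exists_inP[a Aa /negPn/eqP]; exists a.
have missA h v : h \in missing -> f v = Some h -> v \notin A.
  by rewrite inE => /forall_inP nA fv; apply/negP => /nA; rewrite fv eqxx.
(* Branch sets meeting [A] contain distinct vertices of [A], so at most [#|A|] of the [#|A| + 3]
   labels are not missing. *)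
have card_missing : 2 < #|missing|.
  have leA : #|~: missing| <= #|A|.
    rewrite -(card_imset _ (@Some_inj _)); apply: leq_trans (leq_imset_card f A).
    apply/subset_leq_card/subsetP => _ /imsetP[h + ->]; rewrite inE => /meetA[a Aa <-].
    exact: imset_f.
  have := cardsC missing; rewrite card_ord => eq_card.
  rewrite -(leq_add2l #|A|) [leqRHS]addnC.
  by apply: leq_trans (eq_leq (esym eq_card)) _; rewrite leq_add2l.
have old_adj u v : u \notin A -> make_clique_adj A u v = adj u v.
  by move=> nAu; rewrite /make_clique_adj (negPf nAu) andbF orbF.
have fiber_conn h u v : h \in missing -> f u = Some h -> f v = Some h ->
    connect (induced (@adj G) (predC (mem A))) u v.
  move=> Mh fu fv; apply: (connect_homo (g := id)) (model_conn Mf fu fv) => a b.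
  case/and3P=> ab /eqP/(missA _ _ Mh) nAa /eqP/(missA _ _ Mh) nAb.
  by apply: connect1; rewrite /= -old_adj // ab nAa.
have adj_conn h k u v : h \in missing -> k \in missing -> Kminus_adj h k ->
    f u = Some h -> f v = Some k -> connect (induced (@adj G) (predC (mem A))) u v.
  move=> Mh Mk hk fu fv; have [a [b [fa fb ab]]] := model_adj Mf hk.
  apply: connect_trans (fiber_conn h u a Mh fu fa) _.
  apply: connect_trans (fiber_conn k b v Mk fb fv); apply: connect1.
  have [nAa nAb] := (missA _ _ Mh fa, missA _ _ Mk fb).
  by rewrite /= -old_adj // ab nAa.
have /card_gt0P[h0 Mh0] : 0 < #|missing| by apply: leq_trans card_missing.
have [c fc] := model_onto Mf h0.
have nAc := missA _ _ Mh0 fc; set C := region (predC (mem A)) c.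
have CA v : v \in C -> v \notin A by apply: region_sub.
(* The only distinct nonadjacent labels are 0 and 1. If [h0] and [h] are these two, a third missing
   label [l] is adjacent to both and links their branch sets. *)
have missC h v : h \in missing -> f v = Some h -> v \in C.
  move=> Mh fv.
  have [eh|nh] := eqVneq h h0; first by rewrite inE; apply: (fiber_conn h0); rewrite // -eh.
  case hh0: (Kminus_adj h0 h); first by rewrite inE; apply: adj_conn hh0 fc fv.
  have [l Ml nl] : exists2 l, l \in missing & l \notin [set h0; h].
    apply/subsetPn; apply: contraL card_missing => /subset_leq_card le2.
    by rewrite -leqNgt (leq_trans le2) // cards2; case: eqP.
  have [w fw] := model_onto Mf l.
  suff [h0l lh] : Kminus_adj h0 l /\ Kminus_adj l h.
    rewrite inE.
    by apply: connect_trans (adj_conn _ _ _ _ _ _ h0l fc fw) (adj_conn _ _ _ _ _ _ lh fw fv).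
  move: hh0 nl; rewrite /Kminus_adj (eq_sym h0) nh => /negbFE.
  rewrite /same_pair !inE -!val_eqE /=.
  by case/orP=> /andP[/eqP-> /eqP->]; case: (nat_of_ord l) => [|[|?]].
have few : #|B :&: C| <= 2 by apply: region_few.
pose D := A :|: C; pose F v := if v \in D then f v else None.
have exitD u v : u \in D -> v \notin D -> make_clique_adj A u v -> u \in A.
  case/setUP=> // Cu; rewrite in_setU => /norP[nAv nCv]; rewrite old_adj ?CA // => uv.
  by case/negP: nCv; apply: region_step Cu uv _.
have FD v h : F v = Some h -> v \in D /\ f v = Some h by rewrite /F; case: ifP.
have DF v h : v \in D -> f v = Some h -> F v = Some h by rewrite /F => ->.
have cliqueA u v : u \in A -> v \in A -> u != v -> make_clique_adj A u v.
  by rewrite /make_clique_adj => -> -> ->; rewrite orbT.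
(* A label occurring outside [D] is not missing, because missing branch sets lie in [C]; it
   therefore has a representative in [A]. *)
have rep v h : f v = Some h ->
    exists2 w, F w = Some h & w = v /\ v \in D \/ w \in A /\ v \notin D.
  move=> fv; case Dv: (v \in D); first by exists v; [apply: DF | left].
  have [a Aa fa] : exists2 a, a \in A & f a = Some h.
    apply: meetA; apply: contraFN Dv => Mh.
    by rewrite in_setU (missC h v Mh fv) orbT.
  by exists a; [apply: DF; rewrite // in_setU Aa | right].
have MF : model (make_clique_adj A) F.
  split=> [h|h u v /FD[Du fu] /FD[Dv fv]|h k hk].
  - by have [v /rep[w Fw _]] := model_onto Mf h; exists w.
  - case Mh: (h \in missing).
      apply: (connect_homo (g := id)) (model_conn Mf fu fv) => a b.
      case/and3P=> ab /eqP fa /eqP fb; apply: connect1.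
      by rewrite /= ab !(DF _ h) ?eqxx // in_setU (missC h) ?orbT.
    have [a Aa fa] := meetA h (negbT Mh).
    have Da : a \in D by rewrite in_setU Aa.
    (* Collapsing everything outside [D] to [a] keeps the branch set connected: edges leave [D] only
       from [A], whose vertices are adjacent or equal to [a]. *)
    pose g w := if w \in D then w else a.
    have gD w : w \in D -> g w = w by rewrite /g => ->.
    have := connect_homo (g := g) (e' := induced (make_clique_adj A) (fiber F h))
      _ (model_conn Mf fu fv).
    rewrite !gD //; apply=> p q /and3P[pq /eqP fp /eqP fq].
    have toA w : w \in A -> f w = Some h ->
        connect (induced (make_clique_adj A) (fiber F h)) w a.
      move=> Aw fw; have [->|wa] := eqVneq w a; first exact: connect0.
      by apply: connect1; rewrite /= cliqueA // !(DF _ h) ?eqxx // in_setU Aw.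
    rewrite /g; case Dp: (p \in D); case Dq: (q \in D).
    + by apply: connect1; rewrite /= pq !(DF _ h) ?eqxx.
    + by apply: toA fp; apply: exitD pq; rewrite // Dq.
    + rewrite (induced_sym _ (@make_clique_sym G A)); apply: toA fq.
      by rewrite make_clique_sym in pq; apply: exitD pq; rewrite // Dp.
    + exact: connect0.
  - have [u [v [fu fv uv]]] := model_adj Mf hk.
    have [u' Fu Hu] := rep _ _ fu; have [v' Fv Hv] := rep _ _ fv.
    exists u', v'; split=> //.
    have nuv : u' != v'.
      apply: contraTneq hk => euv; suff -> : h = k by rewrite adj_irrefl.
      by apply: Some_inj; rewrite -Fu -Fv euv.
    (* If either end of the edge is outside [D], the other is in [A] or also outside, so both
       representatives lie in the clique [A]. *)
    case: Hu Hv => [[eu Du]|[Au nDu]] [[ev Dv]|[Av nDv]].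
    + by rewrite eu ev.
    + by apply: cliqueA => //; rewrite eu; apply: exitD nDv uv.
    + apply: cliqueA => //; rewrite ev; apply: (exitD v u) => //.
      by rewrite make_clique_sym.
    + exact: cliqueA.
(* Vertices of [B] outside [C] are outside [D], hence unlabelled; at most two vertices of [B] are
   lost this way, and [#|A| + 3 <= #|B|]. *)
apply/freeG/(make_clique_minor MF); apply: (@leq_trans #|B :\: C|).
  rewrite cardsD -(leq_add2r 2) (leq_trans _ (leq_trans leAB _)) ?leq_add2l //.
  by rewrite addnC -leq_subLR leq_sub2l.
apply/subset_leq_card/subsetP => b; case/setDP=> Bb nCb.
by rewrite inE Bb /F in_setU (disjointFl dAB Bb) (negPf nCb).
Qed.

End CommonNeighbours.

Theorem theorem3p2 (R : realFieldType) (r n : nat) (G : sgraph)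
    (A B : {set G}) (delta : R)
    (hr : (4 <= r)%N)
    (hn : #|G| = n)
    (hG : minor_free (Kminus r) G)
    (hAB : [disjoint A & B])
    (hA : #|A| = (r - 3)%N)
    (hdelta : (0 <= delta)%R)
    (hB : (#|B|%:R = (1 - delta) * n%:R :> R)%R)
    (hdn : ((1 - 3 * delta) * n%:R > r%:R :> R)%R)
    (hadj : forall a b : G, a \in A -> b \in B -> adj a b) :
  minor_free (Kminus r) (make_clique A).
Proof.
have er : r = #|A| + 3 by rewrite hA subnK // ltnW.
have leB : r <= #|B|.
  (* As [delta] is nonnegative, [r < (1 - 3 * delta) * n <= (1 - delta) * n], and the last term is
     the size of [B]. *)
  rewrite -(ler_nat R) hB; apply: ltW (lt_le_trans hdn _).
  by apply: ler_wpM2r; [apply: ler0n | lra].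
subst r; exact: make_clique_minor_free hadj leB hG.
Qed.
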